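(* Let $G$ be a countable amenable group. Every free continuous action $G\curvearrowright X$ on a zero-dimensional compact metrizable space is almost finite in measure.
   Context: Fix a compatible metric on $X$. Lower density of $A\subseteq X$: $\underline{D}(A)=\sup_F\inf_{x\in X}\frac{1}{|F|}\sum_{s\in F}1_A(sx)$, where $F$ ranges over the nonempty finite subsets of $G$. A finite set $F\subseteq G$ is $(K,\delta)$-invariant if $|KF\,\Delta\, F|<\delta|F|$. A tower is a pair $(V,S)$ with $V\subseteq X$ and $S\subseteq G$ finite such that the sets $sV$, $s\in S$ (its levels), are pairwise disjoint; $S$ is its shape. A castle is a finite collection of towers $\{(V_i,S_i)\}_{i\in I}$ such that the sets $S_iV_i$, $i\in I$, are pairwise disjoint; it is open if each $V_i$ is open. A free action $G\curvearrowright X$ is almost finite in measure if for every finite set $K\subseteq G$ and $\delta,\varepsilon>0$ there is an open castle $\{(V_i,S_i)\}_{i\in I}$ with levels of diameter less than $\delta$ such that each shape $S_i$ is $(K,\delta)$-invariant and $\underline{D}(\bigsqcup_{i\in I}S_iV_i)\geq 1-\varepsilon$. *)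

(* Defs.v *)
From HB Require Import structures.
From mathcomp Require Import all_boot all_order all_algebra finmap.
From mathcomp Require Import all_classical all_reals all_analysis.

Set Implicit Arguments.
Unset Strict Implicit.
Unset Printing Implicit Defensive.

Import Order.TTheory GRing.Theory Num.Theory.

Local Open Scope classical_set_scope.
Local Open Scope ring_scope.

(* A (discrete) group is amenable if it carries a finitely additive,
   left-invariant probability measure defined on all of its subsets. *)
Definition amenable (R : realType) (G : groupType) : Prop :=
  exists m : set G -> R,
    [/\ forall A, 0 <= m A,
        m setT = 1,
        forall A B, A `&` B = set0 -> m (A `|` B) = m A + m B &
        forall g A, m ((fun h => g * h)%g @` A) = m A].

Definition group_action (G : groupType) (X : Type) (act : G -> X -> X) : Prop :=
  (forall x, act 1%g x = x) /\
  (forall g h x, act (g * h)%g x = act g (act h x)).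

Definition free_action (G : groupType) (X : Type) (act : G -> X -> X) : Prop :=
  forall g x, act g x = x -> g = 1%g.

Definition invariant_set (R : realType) (G : groupType)
    (K : {fset G}) (delta : R) (F : {fset G}) : Prop :=
  let KF := [fset (k * f)%g | k in K, f in F]%fset in
  #|` ((KF `\` F) `|` (F `\` KF))%fset|%:R < delta * #|` F|%:R.

(* The bounds are taken in the extended reals, so that the infimum over an
   empty space is +oo. *)
Definition lower_density (R : realType) (G : groupType) (X : Type)
    (act : G -> X -> X) (A : set X) : \bar R :=
  ereal_sup [set ereal_inf
      [set ((\sum_(s <- F) \1_A (act s x)) / #|` F|%:R)%:E | x in [set: X]]
    | F in [set F : {fset G} | F != fset0]].

(* By this convention the diameter of the empty set is -oo. *)
Definition diameter (R : realType) (X : metricType R) (A : set X) : \bar R :=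
  ereal_sup [set (mdist p.1 p.2)%:E | p in A `*` A].

Section castles.
Context (G : groupType) (X : Type) (act : G -> X -> X).

Definition is_tower (V : set X) (S : {fset G}) : Prop :=
  trivIset [set` S] (fun s => act s @` V).

Definition tower_support (V : set X) (S : {fset G}) : set X :=
  \bigcup_(s in [set` S]) (act s @` V).

Definition is_castle (I : finType) (V : I -> set X) (S : I -> {fset G}) : Prop :=
  (forall i, is_tower (V i) (S i)) /\
  trivIset [set: I] (fun i => tower_support (V i) (S i)).

Definition castle_support (I : finType) (V : I -> set X) (S : I -> {fset G})
    : set X :=
  \bigcup_(i in [set: I]) tower_support (V i) (S i).

End castles.

(* K ranges over nonempty finite sets: when K is empty and delta <= 1, no set F
   at all (not even the empty one) satisfies |KF Delta F| < delta |F|. *)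
Definition almost_finite_in_measure (R : realType) (G : groupType)
    (X : metricType R) (act : G -> X -> X) : Prop :=
  forall (K : {fset G}) (delta epsilon : R),
    K != fset0 -> 0 < delta -> 0 < epsilon ->
    exists (I : finType) (V : I -> set X) (S : I -> {fset G}),
      [/\ is_castle act V S,
          forall i, open (V i),
          forall i s, s \in S i -> (diameter (act s @` V i) < delta%:E)%E,
          forall i, invariant_set K delta (S i) &
          ((1 - epsilon)%:E <= lower_density R act (castle_support act V S))%E].

(* Main.v *)
Require Import Defs.
From mathcomp Require Import all_boot all_order all_algebra finmap.
From mathcomp Require Import all_classical all_reals all_analysis.
From mathcomp Require Import ring lra zify.

Set Implicit Arguments.
Unset Strict Implicit.
Unset Printing Implicit Defensive.

Import Order.TTheory GRing.Theory Num.Theory.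
Import numFieldNormedType.Exports.

Local Open Scope classical_set_scope.
Local Open Scope ring_scope.

(** The proof is the Ornstein-Weiss quasitiling argument, carried out with clopen
    sets.

    Invariant means enter only through Følner sets ([folner_exists]). If no finite
    set were almost invariant, some finite [K] would satisfy [#|K F| >= 2 #|F|] for
    all finite [F]; Hall's theorem ([hall_injection]) would then split off two
    disjoint copies of [G] inside [G] by piecewise translations, and an invariant
    mean would give the whole group mass at least two.

    Fix a small [tau] and a Følner set [F]. Since the action is free and [X] is
    zero-dimensional and compact, [X] is covered by finitely many clopen sets [Y]
    whose images [s Y], [s \in F], are small and pairwise disjoint
    ([free_action_local], [clopen_cover]). Going through these [Y], every point
    [y] of [Y] such that at most a proportion [tau] of the tile [F y] is covered
    becomes the centre of a new tile, which is [F y] trimmed to its uncovered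
    part. The trimmed shape still has [(1 - tau) #|F|] elements and hence inherits
    the invariance of [F] ([invariant_trimmed]); the centres with a given shape
    form a clopen set, so this adds finitely many clopen towers. At the end at
    least a proportion [tau] of every [F x] is covered ([tiled_fill]).

    If this is done on top of a castle with support [A], the density of the
    uncovered part drops by the factor [1 - tau], up to the density of the points
    of [A] that some [s \in F] moves out of [A] ([uncovered_step]). The latter is
    negligible when [A] is made of tiles much more invariant than [F]
    ([exits_step]). The sets [F] are therefore used from the most to the least
    invariant, and [n] rounds leave a part of density about [(1 - tau) ^ n]
    ([exhaustion]).

    Densities are compared through the predicate [mean_le0], which is closed under
    sums and contains the differences of translates of an indicator function, so
    that each estimate reduces to a pointwise inequality modulo such
    differences. *)

(** * Hall's marriage theorem for countably many finite sets *)

Section Hall.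
Context {I T : choiceType}.
Implicit Types (N : I -> {fset T}) (J K : {fset I}).

Definition neighbours N J : {fset T} := (\bigcup_(i <- J) N i)%fset.

Definition hall N := forall J, (#|` J| <= #|` neighbours N J|)%N.

Lemma neighboursP N J x :
  reflect (exists2 i, i \in J & x \in N i) (x \in neighbours N J).
Proof.
apply: (iffP (bigfcupP _ _ _ _)) => [[i /andP[iJ _] xi]|[i iJ xi]];
  by exists i; rewrite ?iJ.
Qed.

Lemma neighboursU N J K :
  neighbours N (J `|` K)%fset = (neighbours N J `|` neighbours N K)%fset.
Proof.
apply/fsetP => x; rewrite in_fsetU; apply/neighboursP/orP.
- by move=> [i]; rewrite in_fsetU => /orP[iJ|iK] xi;
    [left|right]; apply/neighboursP; exists i.
- by move=> [|] /neighboursP[i iJ xi]; exists i; rewrite // in_fsetU iJ ?orbT.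
Qed.

(** Under Hall's condition the sets with no surplus of neighbours are closed
    under unions, because the number of neighbours is submodular. *)
Lemma tightU N J K : hall N ->
  (#|` neighbours N J| <= #|` J|)%N -> (#|` neighbours N K| <= #|` K|)%N ->
  (#|` neighbours N (J `|` K)%fset| <= #|` (J `|` K)%fset|)%N.
Proof.
move=> hN hJ hK; rewrite neighboursU.
have e1 := cardfsUI (neighbours N J) (neighbours N K).
have e2 := cardfsUI J K.
have h3 := hN (J `&` K)%fset.
have h4 : (#|` neighbours N (J `&` K)%fset| <=
           #|` (neighbours N J `&` neighbours N K)%fset|)%N.
  apply/fsubset_leq_card/fsubsetP => x /neighboursP[i].
  rewrite in_fsetI => /andP[iJ iK] xi.
  by rewrite in_fsetI; apply/andP; split; apply/neighboursP; exists i.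
lia.
Qed.

(** If no choice [x] in [N i] were admissible, every element of [N i] would lie
    in the neighbourhood of a tight set avoiding [i]; the union of these tight
    sets together with [i] would violate Hall's condition. *)
Lemma hall_shrink N i : hall N ->
  exists2 x, x \in N i & hall (fun j => if j == i then [fset x]%fset else N j).
Proof.
move=> hN; apply: contrapT => nex.
have tight x : x \in N i -> exists J, [/\ i \notin J,
    (#|` neighbours N J| <= #|` J|)%N & x \in neighbours N J].
  move=> xi; have : ~ hall (fun j => if j == i then [fset x]%fset else N j).
    by move=> h; apply: nex; exists x.
  move=> /existsNP[J /negP]; set N' := (fun j => _); rewrite -ltnNge => ltJ.
  have iJ : i \in J.
    apply: contraTT ltJ => iJ; rewrite -leqNgt; apply: leq_trans (hN J) _.
    apply/fsubset_leq_card/fsubsetP => y /neighboursP[j jJ yj].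
    apply/neighboursP; exists j => //; rewrite /N'.
    by case: eqP => // eji; rewrite -eji jJ in iJ.
  have sub : (neighbours N (J `\ i) `<=` neighbours N' J)%fset.
    apply/fsubsetP => y /neighboursP[j]; rewrite in_fsetD1 => /andP[ji jJ] yj.
    by apply/neighboursP; exists j => //; rewrite /N' (negbTE ji).
  have cJ := cardfsD1 i J; rewrite iJ in cJ.
  have := fsubset_leq_card sub; have := hN (J `\ i)%fset => h1 h2.
  exists (J `\ i)%fset; split; first by rewrite in_fsetD1 eqxx.
    by lia.
  have /eqP -> : neighbours N (J `\ i)%fset == neighbours N' J.
    by rewrite eqEfcard sub /=; lia.
  by apply/neighboursP; exists i => //; rewrite /N' eqxx in_fset1.
have tights (s : seq T) : {subset s <= N i} -> exists J, [/\ i \notin J,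
    (#|` neighbours N J| <= #|` J|)%N & {subset s <= neighbours N J}].
  elim: s => [_|x s IH sub].
    by exists fset0; rewrite in_fset0 /neighbours big_seq_fset0 cardfs0.
  have [J [iJ tJ xJ]] := tight x (sub x (mem_head _ _)).
  have [|K [iK tK sK]] := IH; first by move=> y ys; apply: sub; rewrite inE ys orbT.
  exists (J `|` K)%fset; split; first by rewrite in_fsetU negb_or iJ.
    exact: tightU.
  move=> y; rewrite inE neighboursU in_fsetU => /orP[/eqP ->|/sK ->].
    by rewrite xJ.
  by rewrite orbT.
have [//|J [iJ tJ sJ]] := tights (N i).
have := hN (i |` J)%fset; rewrite cardfsU1 iJ neighboursU => h.
have : (#|` (neighbours N [fset i] `|` neighbours N J)%fset|
        <= #|` neighbours N J|)%N.
  apply/fsubset_leq_card/fsubsetP => y; rewrite in_fsetU => /orP[|//].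
  by move=> /neighboursP[j]; rewrite in_fset1 => /eqP -> /sJ.
by lia.
Qed.

(** The sets [N i] are shrunk to singletons one index at a time, along an
    enumeration of the indices; any two indices are settled after finitely many
    steps, so Hall's condition for that pair survives in the limit. *)
Lemma hall_injection N : countable [set: I] -> hall N ->
  exists2 f : I -> T, injective f & forall i, f i \in N i.
Proof.
move=> /countable_injP[phi phi_inj] hN.
have {}phi_inj : injective phi by move=> i j; apply: phi_inj; rewrite in_setT.
have step (p : nat * {N | hall N}) : exists N' : {N | hall N},
    (forall j, phi j <> p.1 -> sval N' j = sval p.2 j) /\
    (forall j, phi j = p.1 -> exists2 x, x \in sval p.2 j &
       sval N' j = [fset x]%fset).
  case: p => n [M hM] /=.
  have [[i pi]|noi] := pselect (exists i, phi i = n); last first.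
    by exists (exist _ M hM); split => // j pj; case: noi; exists j.
  have [x xi hx] := hall_shrink i hM.
  exists (exist _ _ hx); split => j /= pj.
    by case: eqP => // ji; case: pj; rewrite ji.
  have -> : j = i by apply: phi_inj; rewrite pi.
  by exists x; rewrite ?eqxx.
have [F hF] := choice step.
pose M := fix M n := if n is n'.+1 then F (n', M n') else exist hall N hN.
have M_sub n i : (sval (M n) i `<=` N i)%fset.
  elim: n => [//|n IH] /=; have [h1 h2] := hF (n, M n).
  have [/h2[x /= xi ->]|/h1 -> //] := pselect (phi i = n).
  by rewrite fsub1set; apply: (fsubsetP IH).
have M_stable i n : (phi i < n)%N -> sval (M n) i = sval (M (phi i).+1) i.
  elim: n => [//|n IH]; rewrite ltnS leq_eqVlt => /orP[/eqP -> //|lt].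
  rewrite -IH //=; have [h1 _] := hF (n, M n); rewrite h1 //= => e.
  by rewrite e ltnn in lt.
have M_single i : exists x, sval (M (phi i).+1) i = [fset x]%fset.
  by have [_ /(_ i erefl)[x _ e]] := hF (phi i, M (phi i)); exists x.
have [f hf] := choice M_single.
exists f => [i j eij|i]; last first.
  by apply: (fsubsetP (M_sub (phi i).+1 i)); rewrite hf in_fset1.
apply: contrapT => /eqP nij.
pose n := (maxn (phi i) (phi j)).+1.
have ei : sval (M n) i = [fset f i]%fset by rewrite M_stable ?hf // ltnS leq_maxl.
have ej : sval (M n) j = [fset f i]%fset.
  by rewrite M_stable ?hf ?eij // ltnS leq_maxr.
have := svalP (M n) [fset i; j]%fset.
rewrite cardfs2 nij => le2.
have : (#|` neighbours (sval (M n)) [fset i; j]%fset| <= #|` [fset f i]%fset|)%N.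
  apply/fsubset_leq_card/fsubsetP => y /neighboursP[k].
  by rewrite in_fset2 => /orP[] /eqP ->; rewrite ?ei ?ej.
by rewrite cardfs1; lia.
Qed.

End Hall.

(** * Invariant means and Følner sets *)

Section Folner.
Context {R : realType} {G : groupType}.
Implicit Types (K L F S : {fset G}) (g h : G).

Definition translate g F : {fset G} := [fset (g * f)%g | f in F]%fset.

Definition mulfset K F : {fset G} := [fset (k * f)%g | k in K, f in F]%fset.

Definition folner L (beta : R) F :=
  F != fset0 /\
  forall g, g \in L -> #|` (translate g F `\` F)%fset|%:R <= beta * #|` F|%:R.

Lemma card_translate g F : #|` translate g F| = #|` F|.
Proof. by rewrite card_imfset //; apply: mulgI. Qed.

Lemma translateP g F x : (x \in translate g F) = ((g^-1 * x)%g \in F).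
Proof.
apply/imfsetP/idP => [[f /= fF ->]|xF]; first by rewrite mulKg.
by exists (g^-1 * x)%g; rewrite ?mulVKg.
Qed.

Lemma card_translateD g F :
  #|` (F `\` translate g F)%fset| = #|` (translate g F `\` F)%fset|.
Proof.
have e1 := cardfsID F (translate g F); have e2 := cardfsID (translate g F) F.
by move: e1 e2; rewrite card_translate fsetIC; lia.
Qed.

Lemma folner_sub L L' (beta beta' : R) F :
  (L `<=` L')%fset -> beta' <= beta -> folner L' beta' F -> folner L beta F.
Proof.
move=> /fsubsetP sub le [F0 hF]; split => // g /sub gL.
by apply: le_trans (hF g gL) _; rewrite ler_wpM2r.
Qed.

Section mean.
Context (m : set G -> R).
Hypothesis m0 : forall A, 0 <= m A.
Hypothesis m1 : m setT = 1.
Hypothesis mD : forall A B, A `&` B = set0 -> m (A `|` B) = m A + m B.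
Hypothesis mM : forall g A, m ((fun h => g * h)%g @` A) = m A.

(** Finite additivity suffices because only finitely many translations occur:
    the elements of [s] are treated one at a time. *)
Lemma mean_piecewise_translation (phi : G -> G) (s : seq G) :
  injective phi -> uniq s ->
  m (phi @` [set g | (phi g / g)%g \in s]) = m [set g | (phi g / g)%g \in s].
Proof.
move=> phi_inj; elim: s => [_|k s IH /= /andP[ks us]].
  have -> // : phi @` [set g | (phi g / g)%g \in [::]] =
    [set g | (phi g / g)%g \in [::]].
  by apply/seteqP; split => x //= -[].
have -> : [set g | (phi g / g)%g \in k :: s] =
    [set g | (phi g / g)%g = k] `|` [set g | (phi g / g)%g \in s].
  apply/seteqP; split => x /=; rewrite inE; first by case/predU1P; [left|right].
  by case=> [->|->]; rewrite ?eqxx ?orbT.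
have dis : [set g | (phi g / g)%g = k] `&` [set g | (phi g / g)%g \in s] = set0.
  by apply/seteqP; split => x //= [-> xs]; rewrite xs in ks.
rewrite image_setU mD; last first.
  apply/seteqP; split => x //= [[y yk <-] [z zs /phi_inj eyz]].
  by have : set0 y by rewrite -dis; split; rewrite //= -eyz.
rewrite mD // IH //; congr (_ + _).
rewrite -(mM k [set g | (phi g / g)%g = k]); congr m.
apply/seteqP; split => x /= [y yk <-]; exists y => //.
  by rewrite -yk mulgVK.
by rewrite -yk mulgVK.
Qed.

(** Both [f (-, true)] and [f (-, false)] are piecewise translations, so their
    disjoint images would each have mass one. *)
Lemma not_paradoxical K (f : G * bool -> G) :
  injective f -> ~ forall p, (f p / p.1)%g \in K.
Proof.
move=> f_inj hf.
have img b : m ((fun g => f (g, b)) @` setT) = 1.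
  have inj : injective (fun g => f (g, b)) by move=> g h /f_inj [].
  have := mean_piecewise_translation inj (fset_uniq K).
  have -> : [set g | (f (g, b) / g)%g \in (K : seq G)] = setT.
    by apply/seteqP; split => // g _; apply: (hf (g, b)).
  by move=> ->.
have dis : ((fun g => f (g, true)) @` setT) `&` ((fun g => f (g, false)) @` setT)
    = set0.
  by apply/seteqP; split => x //= [[y _ <-] [z _ /f_inj []]].
set A := (X in X `&` _ = _) in dis; set B := (X in _ `&` X = _) in dis.
have := mD (setICr (A `|` B)); rewrite setUCr m1 mD // !img.
have := m0 (~` (A `|` B)); lra.
Qed.

End mean.

Definition expands K (c : R) :=
  forall F, c * #|` F|%:R <= #|` mulfset K F|%:R.

Lemma expandsM K L (c d : R) : 0 <= d -> expands K c -> expands L d ->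
  expands (mulfset L K) (d * c).
Proof.
move=> d0 hK hL F; have -> : mulfset (mulfset L K) F = mulfset L (mulfset K F).
  apply/fsetP => x; apply/imfset2P/imfset2P.
    move=> [_ /imfset2P[l /= lL [k kK ->]] [f fF ->]].
    exists l => //; exists (k * f)%g; last by rewrite mulgA.
    by apply/imfset2P; exists k => //; exists f.
  move=> [l /= lL [_ /imfset2P[k /= kK [f fF ->]] ->]].
  exists (l * k)%g; last by exists f; rewrite ?mulgA.
  by apply/imfset2P; exists l => //; exists k.
by apply: le_trans (hL _); rewrite -mulrA ler_wpM2l.
Qed.

(** Without Følner sets for [(L, beta)], left multiplication by [L + 1] enlarges
    every finite set by a factor [1 + beta], so a power of it doubles them. *)
Lemma expands_double L (beta : R) :
  0 < beta -> (forall F, ~ folner L beta F) -> exists K, expands K 2.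
Proof.
move=> beta0 nofol; set L1 := (1%g |` L)%fset.
have hL1 : expands L1 (1 + beta).
  move=> F; have [->|F0] := eqVneq F fset0; first by rewrite cardfs0 mulr0.
  have : ~ forall g, g \in L ->
      #|` (translate g F `\` F)%fset|%:R <= beta * #|` F|%:R.
    by move=> h; apply: (nofol F).
  move=> /existsNP[g /not_implyP[gL /negP]]; rewrite -ltNge => lt.
  rewrite mulrDl mul1r; apply: (@le_trans _ _
    (#|` F|%:R + #|` (translate g F `\` F)%fset|%:R)).
    by rewrite lerD2l ltW.
  rewrite -natrD ler_nat.
  have sub : (F `|` (translate g F `\` F) `<=` mulfset L1 F)%fset.
    apply/fsubsetP => x; rewrite in_fsetU in_fsetD => /orP[xF|/andP[_ xF]].
      by apply/imfset2P; exists 1%g; rewrite ?fset1U1 //=;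
        exists x; rewrite ?mul1g.
    move: xF; rewrite translateP => xF.
    apply/imfset2P; exists g; first by rewrite !inE gL orbT.
    by exists (g^-1 * x)%g; rewrite ?mulVKg.
  have := fsubset_leq_card sub; rewrite cardfsU.
  suff -> : (F `&` (translate g F `\` F))%fset = fset0 by rewrite cardfs0 subn0.
  by apply/fsetP => x; rewrite !inE; case: (x \in F).
have pow n : exists K, expands K ((1 + beta) ^+ n).
  elim: n => [|n [K hK]].
    exists [fset 1%g]%fset => F; rewrite expr0 mul1r ler_nat.
    apply/fsubset_leq_card/fsubsetP => x xF; apply/imfset2P.
    by exists 1%g; rewrite ?in_fset1 //; exists x; rewrite ?mul1g.
  exists (mulfset L1 K); rewrite exprS; apply: expandsM => //.
  by rewrite addr_ge0 // ltW.
have bern n : 1 + n%:R * beta <= (1 + beta) ^+ n.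
  elim: n => [|n IH]; first by rewrite mul0r addr0 expr0.
  rewrite exprS; apply: le_trans (ler_wpM2l _ IH); last by rewrite addr_ge0 // ltW.
  rewrite -natr1; have : 0 <= n%:R * beta * beta.
    by rewrite !mulr_ge0 // ltW.
  nra.
pose n := Num.bound beta^-1; have [K hK] := pow n; exists K => F.
apply: le_trans (hK F); rewrite ler_wpM2r //; apply: le_trans (bern n).
have : beta^-1 < n%:R by rewrite archi_boundP // invr_ge0 ltW.
by rewrite -(ltr_pM2r beta0) mulVf ?gt_eqF //; lra.
Qed.

(** Otherwise some [K] doubles all finite sets, and Hall's theorem provides two
    injections of [G] into itself with disjoint images which move points by
    elements of [K] only; an invariant mean would give both images mass one. *)
Lemma folner_exists L (beta : R) : countable [set: G] -> amenable R G ->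
  0 < beta -> exists F, folner L beta F.
Proof.
move=> cG [m [m0 m1 mD mM]] beta0; apply: contrapT => /forallNP nofol.
have [K hK] := expands_double beta0 nofol.
pose N (p : G * bool) := [fset (k * p.1)%g | k in K]%fset.
have hN : hall N.
  move=> J; pose J1 := [fset p.1 | p in J]%fset.
  (* at most two elements of [J] lie over each point of [J1] *)
  have le1 : (#|` J| <= 2 * #|` J1|)%N.
    have sub : (J `<=` [fset (g, true) | g in J1] `|` [fset (g, false) | g in J1])%fset.
      apply/fsubsetP => -[g b] pJ; have gJ : g \in J1 by apply/imfsetP; exists (g, b).
      by rewrite in_fsetU; case: b {pJ}; apply/orP; [left|right];
        apply/imfsetP; exists g.
    apply: leq_trans (fsubset_leq_card sub) _; rewrite cardfsU.
    have card_pair b : #|` [fset (g, b) | g in J1]%fset| = #|` J1|.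
      by rewrite card_imfset // => ? ? [].
    by rewrite !card_pair; lia.
  apply: leq_trans le1 _; have := hK J1; rewrite -natrM ler_nat => /leq_trans; apply.
  apply/fsubset_leq_card/fsubsetP => x /imfset2P[k /= kK [_ /imfsetP[p /= pJ ->] ->]].
  by apply/neighboursP; exists p => //; apply/imfsetP; exists k.
have [|f f_inj hf] := hall_injection _ hN.
  have /countable_injP[phi phi_inj] := cG.
  apply/countable_injP; exists (fun p : G * bool => (phi p.1).*2 + p.2)%N.
  move=> [g b] [h c] _ _ /= e.
  have [e1 e2] : phi g = phi h /\ (b : nat) = c by case: b c e => -[] /= e; split; lia.
  by rewrite (phi_inj _ _ _ _ e1) ?in_setT //; case: b c e2 {e} => -[].
apply: (not_paradoxical m0 m1 mD mM f_inj (K := K)) => p.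
by have /imfsetP[k /= kK ->] := hf p; rewrite mulgK.
Qed.

End Folner.

(** * Functions with nonpositive upper mean *)

Section mean_le0.
Context {R : realType} {G : groupType} {X : Type} (act : G -> X -> X).
Hypothesis hact : group_action act.
Implicit Types (f h : X -> R) (L F : {fset G}).

(** For bounded [f] this amounts to [f] having nonpositive integral for every
    invariant mean on [X]; stated with finite averages it needs no limit of
    measures, and the uniformity in [x] is the one asked of lower densities. *)
Definition mean_le0 f := forall eta : R, 0 < eta -> exists L (beta : R),
  0 < beta /\ forall F, folner L beta F ->
    forall x, \sum_(s <- F) f (act s x) <= eta * #|` F|%:R.

Lemma mean_le0_le f h : (forall x, f x <= h x) -> mean_le0 h -> mean_le0 f.
Proof.
move=> fh hh eta /hh[L [beta [beta0 hF]]]; exists L, beta; split => // F /hF hx x.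
by apply: le_trans (hx x); apply: ler_sum.
Qed.

Lemma mean_le0_0 : mean_le0 (fun=> 0).
Proof.
move=> eta eta0; exists fset0, 1; split => // F _ x.
by rewrite big1 // mulr_ge0 // ltW.
Qed.

Lemma mean_le0D f h : mean_le0 f -> mean_le0 h -> mean_le0 (fun x => f x + h x).
Proof.
move=> hf hh eta eta0; have eta2 : 0 < eta / 2 by lra.
have [L [b [b0 hL]]] := hf _ eta2; have [K [c [c0 hK]]] := hh _ eta2.
exists (L `|` K)%fset, (Num.min b c); split; first by rewrite lt_min b0.
move=> F hF x; rewrite big_split /= [X in _ <= X * _](splitr eta) mulrDl.
apply: lerD; [apply: hL|apply: hK]; apply: folner_sub hF.
- exact: fsubsetUl.
- by rewrite ge_min lexx.
- exact: fsubsetUr.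
- by rewrite ge_min lexx orbT.
Qed.

Lemma mean_le0Z (c : R) f : 0 <= c -> mean_le0 f -> mean_le0 (fun x => c * f x).
Proof.
move=> c0 hf eta eta0.
have c1 : 0 < c + 1 by lra.
have [|L [b [b0 hL]]] := hf (eta / (c + 1)); first by rewrite divr_gt0.
exists L, b; split => // F /hL hF x; rewrite -mulr_sumr.
apply: le_trans (ler_wpM2l c0 (hF x)) _; rewrite mulrA ler_wpM2r //.
by rewrite mulrCA -[X in _ <= X]mulr1 ler_pM2l // ler_pdivrMr //; lra.
Qed.

Lemma mean_le0_sum (I : eqType) (s : seq I) (f : I -> X -> R) :
  (forall i, i \in s -> mean_le0 (f i)) ->
  mean_le0 (fun x => \sum_(i <- s) f i x).
Proof.
elim: s => [_|i s IH hf].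
  by apply: mean_le0_le mean_le0_0 => x; rewrite big_nil.
have {}IH : mean_le0 (fun x => \sum_(j <- s) f j x).
  by apply: IH => j js; apply: hf; rewrite inE js orbT.
apply: mean_le0_le (mean_le0D (hf i (mem_head _ _)) IH) => x.
by rewrite big_cons.
Qed.

(** The average of [h - h \o g] over an almost invariant set [F] only involves
    the points of [F] and [g F] outside their intersection. *)
Lemma mean_le0_coboundary h (g : G) : (forall x, 0 <= h x <= 1) ->
  mean_le0 (fun x => h x - h (act g x)).
Proof.
move=> h01 eta eta0; exists [fset g]%fset, eta; split => // F [_ hF] x.
apply: le_trans (hF g _); last by rewrite in_fset1.
rewrite big_split /= sumrN.
have -> : \sum_(s <- F) h (act g (act s x)) =
    \sum_(s <- translate g F) h (act s x).
  rewrite big_imfset /=; last by move=> ? ? _ _; apply: mulgI.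
  by apply: eq_bigr => s _; rewrite hact.2.
rewrite (big_fsetID _ (mem (translate g F))) [X in _ - X](big_fsetID _ (mem F)) /=.
rewrite -card_translateD.
have -> : [fset s in F | s \in translate g F]%fset =
    [fset s in translate g F | s \in F]%fset.
  by apply/fsetP => s; rewrite !inE andbC.
have -> : [fset s in F | s \notin translate g F]%fset = (F `\` translate g F)%fset.
  by apply/fsetP => s; rewrite !inE andbC.
rewrite addrAC opprD addrA subrr sub0r addrC.
rewrite -sum1_size natr_sum lerBlDr; apply: ler_wpDr.
  by apply: sumr_ge0 => s _; case/andP: (h01 (act s x)).
by apply: ler_sum => s _; case/andP: (h01 (act s x)).
Qed.

Lemma mean_le0_indic (A : set X) g :
  mean_le0 (fun x => \1_A x - \1_A (act g x)).
Proof.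
apply: mean_le0_coboundary => x; rewrite indicE.
by case: (_ \in _); rewrite ler01 lexx.
Qed.

Lemma mean_le0_indicV (A : set X) g :
  mean_le0 (fun x => \1_A (act g x) - \1_A x).
Proof.
have h01 x : 0 <= (\1_A (act g x) : R) <= 1.
  by rewrite indicE; case: (_ \in _); rewrite ler01 lexx.
apply: mean_le0_le (mean_le0_coboundary g^-1%g h01) => x.
by rewrite -hact.2 mulgV hact.1.
Qed.

Lemma lower_density_ge (A : set X) (epsilon eta : R) :
  countable [set: G] -> amenable R G -> eta < epsilon ->
  mean_le0 (fun x => 1 - \1_A x - eta) ->
  ((1 - epsilon)%:E <= lower_density R act A)%E.
Proof.
move=> cG aG lt /(_ (epsilon - eta)); rewrite subr_gt0 => /(_ lt).
move=> [L [beta [beta0 hL]]]; have [F hF] := folner_exists L cG aG beta0.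
have F0 : 0 < #|` F|%:R :> R by rewrite ltr0n cardfs_gt0; case: hF.
apply: (le_trans _ (ereal_sup_ubound _)); last by exists F => //; case: hF.
apply: le_ereal_inf_tmp => _ [x _ <-]; rewrite lee_fin ler_pdivlMr //.
have := hL F hF x; rewrite !big_split /= !sumrN.
have sumc (c : R) : \sum_(s <- F) c = c * #|` F|%:R.
  by rewrite big_const_seq count_predT iter_addr addr0 mulr_natr.
by rewrite !sumc; lra.
Qed.

End mean_le0.

(** * Clopen sets in compact zero-dimensional metric spaces *)

Section clopen.
Context {R : realType} {X : metricType R}.
Implicit Types (U V : set X).

Lemma clopen_bigcup_seq (I : eqType) (s : seq I) (A : I -> set X) :
  (forall i, i \in s -> clopen (A i)) -> clopen (\bigcup_(i in [set` s]) A i).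
Proof.
elim: s => [|i s IH] hA.
  have -> : \bigcup_(i in [set` ([::] : seq I)]) A i = set0.
    by apply/seteqP; split => x // [].
  exact: clopen0.
have -> : \bigcup_(j in [set` i :: s]) A j = A i `|` \bigcup_(j in [set` s]) A j.
  apply/seteqP; split => x /=.
    by move=> [j /=]; rewrite inE => /predU1P[->|js] xj; [left|right; exists j].
  move=> [xi|[j /= js xj]]; first by exists i; rewrite //= mem_head.
  by exists j; rewrite //= inE js orbT.
by apply: clopenU; [apply: hA; rewrite mem_head | apply: IH => j js; apply: hA;
  rewrite inE js orbT].
Qed.

Lemma clopen_bigcap_seq (I : eqType) (s : seq I) (A : I -> set X) :
  (forall i, i \in s -> clopen (A i)) -> clopen (\bigcap_(i in [set` s]) A i).
Proof.
move=> hA; rewrite -[X in clopen X]setCK setC_bigcap; apply: (@clopenC _ _ set0).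
by apply: clopen_bigcup_seq => i /hA h; apply: (@clopenC _ _ set0).
Qed.

Lemma clopen_image (f g : X -> X) V : cancel f g -> cancel g f ->
  continuous g -> clopen V -> clopen (f @` V).
Proof.
move=> fK gK gc cV; have -> : f @` V = g @^-1` V.
  apply/seteqP; split => x /=; first by move=> [y Vy <-]; rewrite fK.
  by move=> Vx; exists (g x).
exact: preimage_clopen.
Qed.

Lemma clopen_cover (P : set X -> Prop) :
  compact [set: X] -> zero_dimensional X ->
  (forall x : X, exists2 U, nbhs x U & forall V, V `<=` U -> P V) ->
  exists Ys : seq (set X), (forall Y, Y \in Ys -> clopen Y /\ P Y) /\
    forall x, exists2 Y, Y \in Ys & Y x.
Proof.
move=> cX zX hP.
have step x : exists V, [/\ clopen V, V x & P V].
  have [U Ux UP] := hP x.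
  have [D [Dx cD] DU] := zero_dimensional_cvg (@metric_hausdorff _ _) zX cX Ux.
  by exists D; split => //; apply: UP.
have [f hf] := choice step.
(* near-covering compactness for the filter of large finite sequences *)
pose B (s : seq X) := [set s' : seq X | {subset s <= s'}].
have FF : Filter (filter_from setT B).
  apply: filter_from_filter; first by exists [::].
  move=> s t _ _; exists (s ++ t) => // u su.
  by split => x xs; apply: su; rewrite mem_cat xs ?orbT.
pose covered (s : seq X) y := exists2 x, x \in s & f x y.
move: (cX) => /compact_near_coveringP/(_ _ _ covered FF)[y _|s _ hs].
  exists (f y, B [:: y]) => [|[z s] /= [fz ys]].
    split; last by exists [:: y].
    by case: (hf y) => -[oy _] yy _; apply: open_nbhs_nbhs.
  by exists y => //; apply: ys; rewrite mem_head.
exists [seq f x | x <- s]; split => [_ /mapP[x _ ->]|y]; first by case: (hf x).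
have [//|x xs xy] := hs s _ y I.
by exists (f x) => //; apply: map_f.
Qed.

End clopen.

(** Freeness separates the finitely many points [s x], [s \in F], so the
    images under [F] of a small enough neighbourhood of [x] are disjoint. *)
Lemma free_action_local (R : realType) (G : groupType) (X : metricType R)
    (act : G -> X -> X) (F : {fset G}) (delta : R) (x : X) :
  group_action act -> (forall g : G, continuous (act g)) -> free_action act ->
  0 < delta ->
  exists2 U, nbhs x U & forall V, V `<=` U ->
    (forall s, s \in F -> (diameter (act s @` V) < delta%:E)%E) /\
    (forall s t y z, s \in F -> t \in F -> V y -> V z ->
       act s y = act t z -> s = t).
Proof.
move=> [act1 actM] hcont hfree delta0.
have [r [r0 r_lt sep]] : exists r : R, [/\ 0 < r, 2 * r < delta &
    forall s t, s \in F -> t \in F -> s != t ->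
      2 * r <= mdist (act s x) (act t x)].
  pose d p := mdist (act p.1 x) (act p.2 x).
  have key (s : seq (G * G)) : exists r : R, [/\ 0 < r, 2 * r < delta &
      forall p, p \in s -> p.1 != p.2 -> 2 * r <= d p].
    elim: s => [|p s [r [r0 rd hr]]].
      by exists (delta / 3); split => //; lra.
    have [ep|np] := eqVneq p.1 p.2.
      exists r; split => // q; rewrite inE => /predU1P[->|]; last exact: hr.
      by rewrite ep eqxx.
    have dp : 0 < d p.
      rewrite mdist_gt0; apply: contraNneq np => e; apply/eqP.
      have : act (p.2^-1 * p.1)%g x = x by rewrite actM e -actM mulVg act1.
      by move=> /hfree e'; rewrite -(mulVKg p.2 p.1) e' mulg1.
    exists (Num.min r (d p / 2)); split.
    - by rewrite lt_min r0 /=; lra.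
    - by apply: le_lt_trans rd; rewrite ler_pM2l // ge_min lexx.
    - move=> q; rewrite inE => /predU1P[->|qs] nq.
        have : Num.min r (d p / 2) <= d p / 2 by rewrite ge_min lexx orbT.
        by lra.
      have : Num.min r (d p / 2) <= r by rewrite ge_min lexx.
      by have := hr q qs nq; lra.
  have [r [r0 rd hr]] := key [seq (s, t) | s <- F, t <- F].
  exists r; split => // s t sF tF st; apply: (hr (s, t)) => //.
  by apply: allpairs_f.
have near (s : seq G) : nbhs x [set y | forall g, g \in s -> mdist (act g x) (act g y) < r].
  elim: s => [|g s IH]; first by apply: filterS filterT => y _ g.
  have /= hg : nbhs x (act g @^-1` ball (act g x) r).
    by apply: hcont; apply: nbhsx_ballx.
  apply: filterS (filterI hg IH) => y [/= yg ys] h; rewrite inE => /predU1P[->|].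
    by move: yg; rewrite ballEmdist.
  exact: ys.
exists [set y | forall g, g \in F -> mdist (act g x) (act g y) < r]; first exact: near.
move=> V VU; split => [s sF|s t y z sF tF Vy Vz e].
  apply: (@le_lt_trans _ _ (2 * r)%:E); last by rewrite lte_fin.
  apply: ge_ereal_sup => _ [[_ _] [[y Vy <-] [z Vz <-]] <-] /=; rewrite lee_fin.
  apply: le_trans (metric_triangle _ (act s x) _) _.
  by have := VU _ Vy _ sF; have := VU _ Vz _ sF; rewrite metric_sym /=; lra.
apply/eqP; apply: contraT => /(sep _ _ sF tF).
have := metric_triangle (act s x) (act s y) (act t x).
rewrite {2}e (metric_sym (act t z)).
by have := VU _ Vy _ sF; have := VU _ Vz _ tF => /=; lra.
Qed.

(** * Clopen castles built tower by tower *)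

Section tiled.
Context {R : realType} {G : groupType} {X : metricType R} (act : G -> X -> X).
Hypothesis hact : group_action act.
Hypothesis hcont : forall g : G, continuous (act g).
Implicit Types (A V C Y : set X) (S F : {fset G}).

Lemma actK g : cancel (act g) (act g^-1%g).
Proof. by move=> x; rewrite -hact.2 mulVg hact.1. Qed.

Lemma actVK g : cancel (act g^-1%g) (act g).
Proof. by move=> x; rewrite -hact.2 mulgV hact.1. Qed.

Lemma clopen_tower_support V S : clopen V -> clopen (tower_support act V S).
Proof.
move=> cV; apply: clopen_bigcup_seq => s _.
by apply: (clopen_image (actK s) (actVK s)).
Qed.

Lemma tower_supportU V W S : tower_support act (V `|` W) S =
  tower_support act V S `|` tower_support act W S.
Proof.
rewrite /tower_support -bigcupU; apply: eq_bigcupr => s _.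
by rewrite image_setU.
Qed.

Section inductive_castle.
Variable P : set X -> {fset G} -> Prop.

(** The supports of castles with clopen bases, generated tower by tower because
    each new tower is cut out of the complement of what is covered already. *)
Inductive tiled : set X -> Prop :=
| tiled0 : tiled set0
| tiledU A V S : tiled A -> clopen V -> P V S -> is_tower act V S ->
    A `&` tower_support act V S = set0 -> tiled (A `|` tower_support act V S).

Lemma tiled_clopen A : tiled A -> clopen A.
Proof.
elim=> [|{}A V S _ cA cV _ _ _]; first exact: clopen0.
by apply: clopenU => //; apply: clopen_tower_support.
Qed.

Lemma tiled_castle A : tiled A ->
  exists (I : finType) (V : I -> set X) (S : I -> {fset G}),
    [/\ is_castle act V S, forall i, clopen (V i), forall i, P (V i) (S i) &
        castle_support act V S = A].
Proof.
elim=> [|{}A V S _ [I [VI [SI [[tw dis] cI PI eA]]]] cV PVS twV disA].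
  exists void, (fun=> set0), (fun=> fset0); split => //; try by case.
    by split; case.
  by apply/seteqP; split => x //= [[]].
pose V' i := if i is Some i then VI i else V.
pose S' i := if i is Some i then SI i else S.
exists (option I), V', S'; split; try by case.
- split; first by case.
  have none i x : tower_support act (VI i) (SI i) x ->
      tower_support act V S x -> False.
    move=> xi xV; have : (A `&` tower_support act V S) x.
      by split => //; rewrite -eA; exists i.
    by rewrite disA.
  move=> [i|] [j|] _ _ //= [x [xi xj]].
  + by congr Some; apply: dis => //; exists x.
  + by case: (none i x).
  + by case: (none j x).
- rewrite -eA; apply/seteqP; split => x.
    by move=> [[i|] _ xi]; [left; exists i | right].
  by move=> [[i _ xi]|xV]; [exists (Some i) | exists None].
Qed.

End inductive_castle.

Lemma sum_tower_indic V S (x : X) : is_tower act V S ->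
  \sum_(s <- S) \1_V (act s^-1%g x) <= \1_(tower_support act V S) x :> R.
Proof.
move=> tw; have [[s sS Vs]|no] := pselect (exists2 s, s \in S & V (act s^-1%g x)).
  rewrite (bigD1_seq s) //= [X in _ + X]big_seq_cond big1 => [|t /andP[tS ts]].
    rewrite addr0 !indicE mem_set // mem_set //.
    by exists s => //; exists (act s^-1%g x) => //; rewrite actVK.
  rewrite indicE memNset // => Vt; move: ts; rewrite (tw t s) ?eqxx //.
  exists x; split; first by exists (act t^-1%g x) => //; rewrite actVK.
  by exists (act s^-1%g x) => //; rewrite actVK.
rewrite big_seq big1 ?indicE // => s sS.
by rewrite indicE memNset // => Vs; apply: no; exists s.
Qed.

(** The indicator of the tower is a sum of translates of that of its base. *)
Lemma mean_le0_tower A V S : is_tower act V S ->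
  A `&` tower_support act V S = set0 ->
  mean_le0 act (fun x => #|` S|%:R * \1_V x + \1_A x
    - \1_(A `|` tower_support act V S) x : R).
Proof.
move=> tw dis; apply: (@mean_le0_le _ _ _ _ _
  (fun x => \sum_(s <- S) (\1_V x - \1_V (act s^-1%g x)))); last first.
  by apply: mean_le0_sum => s _; apply: mean_le0_indic.
move=> x; rewrite sumrB big_const_seq count_predT iter_addr addr0 -mulr_natl.
have le := sum_tower_indic x tw.
suff -> : \1_(A `|` tower_support act V S) x =
    \1_A x + \1_(tower_support act V S) x :> R by lra.
rewrite !indicE in_setU; have [xA|] := boolP (x \in A); last by rewrite add0r.
suff /negbTE -> : x \notin tower_support act V S by rewrite addr0.
apply/negP; rewrite inE => xT; have : (A `&` tower_support act V S) x.
  by split => //; rewrite inE in xA.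
by rewrite dis.
Qed.

End tiled.

(** * Greedy packing of trimmed tiles *)

Section greedy.
Context {R : realType} {G : groupType} {X : metricType R} (act : G -> X -> X).
Hypothesis hact : group_action act.
Hypothesis hcont : forall g : G, continuous (act g).
Context (P : set X -> {fset G} -> Prop) (F : {fset G}) (epsilon : R).
Hypothesis epsilon1 : epsilon <= 1.
Implicit Types (A V C Y : set X) (S : {fset G}).

(** Sets so small that a base inside them makes a tower out of any subset of
    [F], one that qualifies for [P] when at most a proportion [epsilon] of [F]
    has been trimmed. *)
Definition local_base Y :=
  (forall V S, V `<=` Y -> (S `<=` F)%fset ->
    (1 - epsilon) * #|` F|%:R <= #|` S|%:R -> P V S) /\
  (forall s t y z, s \in F -> t \in F -> Y y -> Y z -> act s y = act t z -> s = t).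

(** The shape to which the tile [F y] is trimmed when it is laid over [A]. *)
Definition escape A (y : X) : {fset G} := [fset s in F | act s y \notin A]%fset.

Lemma escapeP A y s : reflect (s \in F /\ ~ A (act s y)) (s \in escape A y).
Proof.
rewrite !inE; apply: (iffP andP) => -[sF].
  by move=> /negP sA; split => // yA; apply: sA; rewrite inE.
by move=> sA; split => //; apply/negP; rewrite inE.
Qed.

Lemma card_escape A y :
  #|` escape A y|%:R = #|` F|%:R - \sum_(s <- F) \1_A (act s y) :> R.
Proof.
rewrite -!sum1_size !natr_sum -sumrB -big_fset_condE.
rewrite [RHS](bigID (fun s => act s y \notin A)) /= [X in _ + X]big1 ?addr0.
  by apply: eq_bigr => s /negbTE sA; rewrite indicE sA subr0.
by move=> s; rewrite negbK => sA; rewrite indicE sA subrr.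
Qed.

Lemma clopen_escape A Y S : clopen A -> clopen Y ->
  clopen (Y `&` [set y | escape A y = S]).
Proof.
move=> cA cY; apply: clopenI => //.
have [SF|nSF] := boolP (S `<=` F)%fset; last first.
  have -> : [set y | escape A y = S] = set0; last exact: clopen0.
  apply/seteqP; split => y //= e; move/negP: nSF; apply; rewrite -e.
  by apply/fsubsetP => s /escapeP[].
have -> : [set y | escape A y = S] = \bigcap_(s in [set` F])
    (if s \in S then ~` (act s @^-1` A) else act s @^-1` A).
  apply/seteqP; split => y /=.
    move=> <- s /= sF; case: escapeP => [[_ h] //|h].
    by apply: contrapT => nA; apply: h.
  move=> h; apply/fsetP => s; apply/escapeP/idP => [[sF nA]|sS].
    by have := h s sF; case: ifP.
  have sF := fsubsetP SF s sS; split => //.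
  by have := h s sF; rewrite /= sS.
apply: clopen_bigcap_seq => s _; case: ifP => _.
  by apply: (@clopenC _ _ set0); apply: preimage_clopen.
exact: preimage_clopen.
Qed.

(** Centres in [Y] are grouped by the shape of their trimmed tile, one tower for
    each shape in [l]. Tiles with distinct centres are disjoint because the
    [F]-images of [Y] are, so every centre contributes at least
    [(1 - epsilon) * #|F|] new points; the bound on means records this. *)
Lemma tiled_add_patterns A Y (l : seq {fset G}) :
  tiled act P A -> clopen Y -> local_base Y -> uniq l ->
  (forall S, S \in l -> (S `<=` F)%fset /\
    (1 - epsilon) * #|` F|%:R <= #|` S|%:R) ->
  let C := Y `&` [set y | escape A y \in l] in
  let A' := A `|` tower_support act C F in
  tiled act P A' /\
  mean_le0 act (fun x => (1 - epsilon) * #|` F|%:R * \1_C x + \1_A x - \1_A' x : R).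
Proof.
move=> tA cY [PY sepY].
elim: l => [_ _ C A'|S l IH /= /andP[Sl ul] hl].
  have C0 : C = set0 by apply/seteqP; split => x //= [].
  have -> : A' = A.
    apply/seteqP; split => x; last by left.
    by case=> // -[s _ [y]]; rewrite C0.
  split => //; apply: mean_le0_le (mean_le0_0 act) => x.
  by rewrite C0 indic0 mulr0 add0r subrr.
have [] := IH ul; first by move=> T Tl; apply: hl; rewrite inE Tl orbT.
set C := Y `&` [set y | escape A y \in l].
set A1 := A `|` tower_support act C F => tA1 mA1.
have [SF cardS] := hl S (mem_head _ _).
pose V := Y `&` [set y | escape A y = S].
have twV : is_tower act V S.
  move=> s t sS tS [x [[y [Yy _] <-] [z [Yz _] /esym]]].
  exact: sepY (fsubsetP SF _ sS) (fsubsetP SF _ tS) Yy Yz.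
have disV : A1 `&` tower_support act V S = set0.
  apply/seteqP; split => x // [xA1 [s sS [y [Yy ey] esy]]].
  have := sS; rewrite /= -ey => /escapeP[sF nA].
  case: xA1 => [xA|[t tF [z [Yz zl] etz]]]; first by apply: nA; rewrite esy.
  have est : s = t by apply: (sepY s t y z) => //; rewrite esy.
  have eyz : y = z by apply: (can_inj (actK hact s)); rewrite esy est.
  by move: zl Sl; rewrite /= -eyz ey => ->.
have eA' : A `|` tower_support act (Y `&` [set y | escape A y \in S :: l]) F =
    A1 `|` tower_support act V S.
  apply/seteqP; split => x.
    move=> [xA|[s sF [y [Yy yl] esy]]]; first by left; left.
    move: yl => /=; rewrite inE => /predU1P[ey|yl]; last first.
      by left; right; exists s => //; exists y.
    have [xA|nA] := pselect (A x); first by left; left.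
    right; exists s; last by exists y.
    by rewrite /= -ey; apply/escapeP; rewrite esy.
  move=> [[xA|[s sF [y [Yy yl] esy]]]|[s sS [y [Yy ey] esy]]]; first by left.
    by right; exists s => //; exists y => //; split; rewrite //= inE yl orbT.
  right; exists s; first exact: (fsubsetP SF).
  by exists y => //; split; rewrite //= inE ey eqxx.
rewrite eA'; split.
  apply: tiledU => //; first by apply: clopen_escape => //; apply: tiled_clopen tA.
  by apply: PY => // x [].
apply: mean_le0_le (mean_le0D mA1 (mean_le0_tower hact twV disV)) => x /=.
set a := \1_A x; set a1 := \1_A1 x; set a2 := \1_(_ `|` _) x.
have : \1_(Y `&` [set y | escape A y \in S :: l]) x <= \1_C x + \1_V x :> R.
  rewrite !indicE; case: (boolP (x \in Y `&` _)) => [|_]; last first.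
    by rewrite addr_ge0.
  rewrite inE => -[Yx] /=; rewrite inE => /predU1P[ex|xl].
    by rewrite [x \in V]mem_set // lerDr.
  by rewrite [x \in C]mem_set // lerDl.
set u := \1_(_ `&` _) x => le_u.
have v0 : 0 <= \1_V x :> R by rewrite indicE.
have : (1 - epsilon) * #|` F|%:R * u <=
    (1 - epsilon) * #|` F|%:R * (\1_C x + \1_V x).
  by rewrite ler_wpM2l // mulr_ge0 // subr_ge0.
have : (1 - epsilon) * #|` F|%:R * \1_V x <= #|` S|%:R * \1_V x.
  by rewrite ler_wpM2r.
rewrite mulrDr; lra.
Qed.

(** After the tiles with centres in [Y] are added, a point [y] of [Y] either was
    the centre of such a tile, whence [F y] is covered, or was rejected because
    more than a proportion [epsilon] of [F y] was covered already. *)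
Lemma tiled_fill_base A Y : tiled act P A -> clopen Y -> local_base Y ->
  exists A' C, [/\ tiled act P A', A' = A `|` tower_support act C F,
    mean_le0 act (fun x => (1 - epsilon) * #|` F|%:R * \1_C x + \1_A x - \1_A' x : R) &
    forall y, Y y -> epsilon * #|` F|%:R <= \sum_(s <- F) \1_A' (act s y)].
Proof.
move=> tA cY lY.
pose l : seq {fset G} := [seq S <- fpowerset F | (1 - epsilon) * #|` F|%:R <= #|` S|%:R].
have [||tA' mA'] := tiled_add_patterns (l := l) tA cY lY.
- by rewrite filter_uniq // fset_uniq.
- by move=> S; rewrite mem_filter => /andP[cS]; rewrite fpowersetE.
set C := (Y `&` _) in tA' mA'; exists (A `|` tower_support act C F), C.
split => // y Yy.
have [yl|yl] := boolP (escape A y \in l).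
  rewrite big_seq (eq_bigr (fun=> 1)); last first.
    move=> s sF; rewrite indicE mem_set //; right.
    by exists s => //; exists y.
  by rewrite -big_seq -[X in _ <= X](natr_sum _ _ _ (fun=> 1%N)) sum1_size ler_piMl.
apply: (@le_trans _ _ (\sum_(s <- F) \1_A (act s y))); last first.
  apply: ler_sum => s _; rewrite !indicE in_setU.
  by case: (_ \in A); rewrite //= lexx.
move: yl; rewrite mem_filter negb_and => /orP[|]; last first.
  rewrite fpowersetE => /negP[]; apply/fsubsetP => s.
  by case/escapeP.
rewrite -ltNge card_escape; lra.
Qed.

Lemma tiled_fill A (Ys : seq (set X)) : tiled act P A ->
  (forall Y, Y \in Ys -> clopen Y /\ local_base Y) ->
  exists A' C, [/\ tiled act P A', A' = A `|` tower_support act C F,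
    mean_le0 act (fun x => (1 - epsilon) * #|` F|%:R * \1_C x + \1_A x - \1_A' x : R) &
    forall Y y, Y \in Ys -> Y y ->
      epsilon * #|` F|%:R <= \sum_(s <- F) \1_A' (act s y)].
Proof.
elim: Ys A => [|Y Ys IH] A tA hY.
  exists A, set0; split => //.
    rewrite /tower_support; apply/seteqP; split => x; first by left.
    by case=> // -[s _ [y]].
  apply: mean_le0_le (mean_le0_0 act) => x.
  by rewrite indic0 mulr0 add0r subrr.
have [cY lY] := hY Y (mem_head _ _).
have [A1 [C1 [tA1 eA1 mA1 fA1]]] := tiled_fill_base tA cY lY.
have [|A2 [C2 [tA2 eA2 mA2 fA2]]] := IH A1 tA1.
  by move=> Z ZYs; apply: hY; rewrite inE ZYs orbT.
exists A2, (C1 `|` C2); split => //.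
- by rewrite eA2 eA1 tower_supportU setUA.
- apply: mean_le0_le (mean_le0D mA1 mA2) => x.
  have : \1_(C1 `|` C2) x <= \1_C1 x + \1_C2 x :> R.
    rewrite !indicE in_setU; case: (x \in C1) => /=; last by rewrite add0r.
    by rewrite lerDl.
  have f0 : 0 <= (1 - epsilon) * #|` F|%:R by rewrite mulr_ge0 // subr_ge0.
  by move=> /(ler_wpM2l f0); rewrite mulrDr; lra.
move=> Z y; rewrite inE => /predU1P[->|ZYs] Zy; last exact: (fA2 Z).
apply: le_trans (fA1 y Zy) _; apply: ler_sum => s _.
by rewrite !indicE eA2 in_setU; case: (_ \in A1).
Qed.

End greedy.

(** * Shapes trimmed from Følner sets *)

Section trimmed.
Context {R : realType} {G : groupType}.
Implicit Types (K F S : {fset G}).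

Lemma card_le_sum (I : eqType) (s : seq I) (A : {fset G}) (B : I -> {fset G}) :
  (forall x, x \in A -> exists2 i, i \in s & x \in B i) ->
  (#|` A| <= \sum_(i <- s) #|` B i|)%N.
Proof.
elim: s A => [|i s IH] A hA.
  rewrite big_nil leqn0 cardfs_eq0; apply/eqP/fsetP => x; rewrite in_fset0.
  by apply/negP => /hA[].
rewrite big_cons -(cardfsID (B i)); apply: leq_add.
  by apply/fsubset_leq_card/fsubsetIr.
apply: IH => x; rewrite in_fsetD => /andP[xi /hA[j]].
by rewrite inE => /predU1P[->|js] xj; [rewrite xj in xi | exists j].
Qed.

(** A point of [k S] outside [S] lies in [k F] outside [F] or in [F] outside [S],
    which leaves at most [2 * tau * #|F|] points for each [k]. The factor [4] is
    this [2] and the one in [#|F| <= 2 * #|S|]; the summand [1] accounts for the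
    points of [S] outside [K S]. *)
Lemma invariant_trimmed K F S (delta tau : R) :
  K != fset0 -> folner K tau F -> (S `<=` F)%fset ->
  (1 - tau) * #|` F|%:R <= #|` S|%:R -> tau <= 2^-1 ->
  4 * tau * (#|` K|%:R + 1) < delta -> invariant_set K delta S.
Proof.
move=> /fset0Pn[k0 k0K] [F0 hF] SF cS tau2 lt_delta.
have F_gt0 : 0 < #|` F|%:R :> R by rewrite ltr0n cardfs_gt0.
have cFS : #|` (F `\` S)%fset|%:R <= tau * #|` F|%:R.
  have := cardfsID S F; rewrite (fsetIidPr SF) => e.
  have : #|` S|%:R + #|` (F `\` S)%fset|%:R = #|` F|%:R :> R by rewrite -natrD e.
  by rewrite mulrBl mul1r in cS; lra.
have ck k : k \in K ->
    #|` (translate k S `\` S)%fset|%:R <= 2 * tau * #|` F|%:R.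
  move=> kK; have sub : (translate k S `\` S `<=`
      (translate k F `\` F) `|` (F `\` S))%fset.
    apply/fsubsetP => x; rewrite !in_fsetE !translateP => /andP[-> /(fsubsetP SF) ->].
    by case: (x \in F).
  have := fsubset_leq_card sub; rewrite cardfsU => le.
  have : #|` (translate k S `\` S)%fset|%:R <=
     #|` (translate k F `\` F)%fset|%:R + #|` (F `\` S)%fset|%:R :> R.
    by rewrite -natrD ler_nat; lia.
  by have := hF k kK; lra.
rewrite /invariant_set -/(mulfset K S) /=.
set D := (_ `|` _)%fset.
have cD : (#|` D| <= \sum_(k <- K) #|` (translate k S `\` S)%fset| +
    #|` (translate k0 S `\` S)%fset|)%N.
  apply: (@leq_trans (#|` (mulfset K S `\` S)%fset| + #|` (S `\` mulfset K S)%fset|)).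
    by rewrite /D cardfsU leq_subr.
  apply: leq_add.
    apply: card_le_sum => x; rewrite in_fsetD => /andP[xS /imfset2P[k /= kK [s sS xks]]].
    by exists k => //; rewrite in_fsetD xS translateP xks mulKg.
  rewrite -card_translateD; apply/fsubset_leq_card/fsetDS/fsubsetP => x.
  rewrite translateP => xS; apply/imfset2P; exists k0 => //.
  by exists (k0^-1 * x)%g; rewrite ?mulVKg.
have {}cD : #|` D|%:R <= (#|` K|%:R + 1) * (2 * tau * #|` F|%:R).
  apply: (@le_trans _ _ (\sum_(k <- K) #|` (translate k S `\` S)%fset|%:R +
    #|` (translate k0 S `\` S)%fset|%:R)); first by rewrite -natr_sum -natrD ler_nat.
  rewrite mulrDl mul1r; apply: lerD; last exact: ck.
  rewrite -[#|` K|]sum1_size natr_sum mulr_suml big_seq [leRHS]big_seq.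
  by apply: ler_sum => k kK; rewrite mul1r ck.
have cS2 : #|` F|%:R <= 2 * #|` S|%:R :> R.
  suff : 2^-1 * #|` F|%:R <= #|` S|%:R :> R by lra.
  by apply: le_trans cS; rewrite ler_wpM2r //; lra.
have tau0 : 0 <= tau by rewrite -(pmulr_lge0 _ F_gt0); apply: le_trans cFS.
have c0 : 0 <= (#|` K|%:R + 1) * (2 * tau) by rewrite !mulr_ge0 // addr_ge0.
apply: le_lt_trans cD _.
apply: (@le_lt_trans _ _ ((#|` K|%:R + 1) * (2 * tau) * (2 * #|` S|%:R))).
  by rewrite mulrA ler_wpM2l.
have S_gt0 : 0 < #|` S|%:R :> R by lra.
have -> : (#|` K|%:R + 1) * (2 * tau) * (2 * #|` S|%:R) =
  4 * tau * (#|` K|%:R + 1) * #|` S|%:R by ring.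
by rewrite ltr_pM2r.
Qed.

End trimmed.

(** * Exhausting the space *)

Section exhaustion.
Context {R : realType} {G : groupType} {X : metricType R} (act : G -> X -> X).
Hypothesis hact : group_action act.
Implicit Types (A V C Y : set X) (L F S : {fset G}).

Definition exits A (g : G) : set X := A `\` (act g @^-1` A).

Section one_step.
Context (F : {fset G}) (tau : R) (A C : set X).
Hypotheses (F0 : F != fset0) (tau2 : tau <= 2^-1).
Let A' := A `|` tower_support act C F.
Hypothesis mA' : mean_le0 act
  (fun x => (1 - tau) * #|` F|%:R * \1_C x + \1_A x - \1_A' x : R).

(** Averaged over [F], the complement of [A'] has density at most [1 - tau] at
    every point, and at a point of [A] it is only seen by the [s \in F] under
    which the point exits [A]. *)
Lemma uncovered_step (d eta : R) :
  (forall y, tau * #|` F|%:R <= \sum_(s <- F) \1_A' (act s y)) ->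
  mean_le0 act (fun x => 1 - \1_A x - d) ->
  (forall s, s \in F -> mean_le0 act (fun x => \1_(exits A s) x - eta)) ->
  mean_le0 act (fun x => 1 - \1_A' x - ((1 - tau) * d + eta)).
Proof.
move=> fill mA mE; set n : R := #|` F|%:R.
have n0 : 0 < n by rewrite ltr0n cardfs_gt0.
have sumc (c : R) : \sum_(s <- F) c = n * c.
  by rewrite big_const_seq count_predT iter_addr addr0 mulr_natl.
have m1 := mean_le0_sum mE.
have m2 := @mean_le0_sum R G X act G F _
  (fun s _ => mean_le0_indicV (R := R) hact A' s).
have tau1 : 0 <= 1 - tau by move: tau2; lra.
have c0 : 0 <= (1 - tau) * n by rewrite mulr_ge0 // ltW.
have := mean_le0D (mean_le0D (mean_le0Z c0 mA) m1) m2.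
have ninv : 0 <= n^-1 by rewrite invr_ge0 ltW.
move=> /(mean_le0Z ninv); apply: mean_le0_le => x.
rewrite ler_pdivlMl // !sumrB !sumc.
have le_avg : n - \sum_(s <- F) \1_A' (act s x) <=
    (1 - tau) * n * (1 - \1_A x) + \sum_(s <- F) \1_(exits A s) x.
  have [xA|xA] := boolP (x \in A); last first.
    rewrite [\1_A x]indicE (negbTE xA) subr0 mulr1.
    have : 0 <= \sum_(s <- F) \1_(exits A s) x :> R.
      by apply: sumr_ge0 => s _; rewrite indicE.
    by have := fill x; rewrite -/n; lra.
  rewrite [\1_A x]indicE xA subrr mulr0 add0r -[n]mulr1 -sumc -sumrB.
  apply: ler_sum => s _; rewrite !indicE.
  have [sA|sA] := boolP (act s x \in A'); first by rewrite subrr.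
  rewrite subr0 mem_set //; split; first by rewrite inE in xA.
  by move=> /= xsA; move/negP: sA; apply; rewrite inE; left.
by lra.
Qed.

(** A point of [F C] exits [F C] under [g] only if its tile sends it to a point
    of [g F] outside [F]; there are few of these per tile, and by disjointness
    of the trimmed tiles the centres have density at most [2 / |F|]. *)
Lemma exits_step (g : G) (beta eta : R) : 0 <= beta ->
  #|` (translate g F `\` F)%fset|%:R <= beta * #|` F|%:R ->
  mean_le0 act (fun x => \1_(exits A g) x - eta) ->
  mean_le0 act (fun x => \1_(exits A' g) x - (eta + 2 * beta)).
Proof.
move=> beta0; set D := (_ `\` _)%fset; set n : R := #|` F|%:R => cD mE.
have beta20 : 0 <= 2 * beta by lra.
have mD : mean_le0 act (fun x => \sum_(u <- D)
    (\1_C (act (u^-1 * g)%g x) - \1_C x : R)).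
  by apply: mean_le0_sum => u _; apply: mean_le0_indicV.
apply: mean_le0_le (mean_le0D (mean_le0D mE (mean_le0Z beta20 mA')) mD) => x.
rewrite sumrB big_const_seq count_predT iter_addr addr0 -mulr_natl.
have le_exit : \1_(exits A' g) x <= \1_(exits A g) x +
    \sum_(u <- D) \1_C (act (u^-1 * g)%g x) :> R.
  have s0 (s : seq G) : 0 <= \sum_(u <- s) \1_C (act (u^-1 * g)%g x) :> R.
    by apply: sumr_ge0 => u _; rewrite indicE.
  rewrite [\1_(exits A' g) x]indicE; case: (boolP (x \in _)) => [|_]; last first.
    by rewrite addr_ge0 // indicE.
  rewrite inE => -[xA' ngA'].
  have ngA : ~ A (act g x) by move=> gA; apply: ngA'; left.
  case: xA' => [xA|[f fF [c Cc efc]]].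
    rewrite [\1_(exits A g) x]indicE [x \in _]mem_set; last by split.
    by rewrite lerDl.
  have uD : (g * f)%g \in D.
    rewrite in_fsetD translateP mulKg fF andbT; apply/negP => gfF.
    by apply: ngA'; right; exists (g * f)%g => //; exists c; rewrite // -efc hact.2.
  have e1 : \1_C (act ((g * f)^-1 * g)%g x) = 1 :> R.
    by rewrite indicE mem_set // -efc -hact.2 -mulgA mulVg hact.1.
  rewrite (bigD1_seq _ uD (fset_uniq D)).
  rewrite e1 addrCA lerDl addr_ge0 ?indicE // -big_filter; exact: s0.
have c0 : 0 <= \1_C x :> R by rewrite indicE.
have a0 : 0 <= \1_A x :> R by rewrite indicE.
have a1 : \1_A' x <= 1 :> R by rewrite indicE; case: (_ \in _).
have nC : n * \1_C x <= 2 * ((1 - tau) * n * \1_C x).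
  have nc0 : 0 <= n * \1_C x by rewrite mulr_ge0.
  by rewrite -mulrA; move: tau2; nra.
have h1 : #|` D|%:R * \1_C x <= 2 * beta * ((1 - tau) * n * \1_C x).
  apply: (@le_trans _ _ (beta * (n * \1_C x))).
    by rewrite mulrA ler_wpM2r.
  by rewrite [2 * beta]mulrC -[leRHS]mulrA ler_wpM2l.
have h2 : 2 * beta * (\1_A' x - \1_A x) <= 2 * beta * 1 by rewrite ler_wpM2l //; lra.
rewrite -/n; lra.
Qed.

End one_step.

Section iteration.
Hypothesis (cG : countable [set: G]) (aG : amenable R G).
Hypothesis (cX : compact [set: X]) (zX : zero_dimensional X).
Hypothesis hcont : forall g : G, continuous (act g).
Hypothesis hfree : free_action act.
Context (delta : R) (good : {fset G} -> Prop) (tau : R).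
Hypotheses (delta0 : 0 < delta) (tau0 : 0 <= tau) (tau2 : tau <= 2^-1).
Context (L0 : {fset G}) (beta0 : R).
Hypothesis beta0_gt0 : 0 < beta0.
Hypothesis good_trimmed : forall F S, folner L0 beta0 F -> (S `<=` F)%fset ->
  (1 - tau) * #|` F|%:R <= #|` S|%:R -> good S.

Definition small_good (V : set X) (S : {fset G}) :=
  (forall s, s \in S -> (diameter (act s @` V) < delta%:E)%E) /\ good S.

Lemma local_cover F : folner L0 beta0 F -> exists Ys : seq (set X),
  (forall Y, Y \in Ys -> clopen Y /\ local_base act small_good F tau Y) /\
  forall x, exists2 Y, Y \in Ys & Y x.
Proof.
move=> hF; apply: clopen_cover => // x.
have [U Ux hU] := free_action_local F x hact hcont hfree delta0.
exists U => // V VU; split; last exact: (hU V VU).2.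
move=> W S WV SF cS; split; last exact: good_trimmed cS.
move=> s sS; apply: (hU W _).1; last exact: (fsubsetP SF).
exact: subset_trans VU.
Qed.

(** Each round lays tiles of a Følner set [F] over the castle of the previous
    rounds. That castle is built after [F] is chosen, out of much more invariant
    tiles, so that few points exit it under the elements of [F]. *)
Lemma exhaustion (n : nat) L (eta : R) : 0 < eta -> exists A,
  [/\ tiled act small_good A,
      mean_le0 act (fun x => 1 - \1_A x - ((1 - tau) ^+ n + eta)) &
      forall g, g \in L -> mean_le0 act (fun x => \1_(exits A g) x - eta)].
Proof.
elim: n L eta => [|n IH] L eta eta0.
  exists set0; split; first exact: tiled0.
    by apply: mean_le0_le (mean_le0_0 act) => x; rewrite indic0 expr0 /=; lra.
  move=> g _; apply: mean_le0_le (mean_le0_0 act) => x.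
  by rewrite /exits set0D indic0 /=; lra.
pose beta := Num.min beta0 (eta / 4).
have beta_gt0 : 0 < beta by rewrite lt_min beta0_gt0 divr_gt0.
have [F hF] := folner_exists (L0 `|` L)%fset cG aG beta_gt0.
have hF0 : folner L0 beta0 F.
  by apply: folner_sub hF; [exact: fsubsetUl | rewrite ge_min lexx].
have eta2 : 0 < eta / 2 by lra.
have [A [tA mA mE]] := IH (L `|` F)%fset _ eta2.
have [Ys [hYs cov]] := local_cover hF0.
have tau1 : tau <= 1 by move: tau2; lra.
have [A' [C [tA' eA' mA' fill]]] := tiled_fill hact hcont tau1 tA hYs.
have F0 := hF.1; rewrite eA' in tA' mA' fill.
exists (A `|` tower_support act C F); split => //.
  have fillT y : tau * #|` F|%:R <=
      \sum_(s <- F) \1_(A `|` tower_support act C F) (act s y).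
    by have [Y YYs Yy] := cov y; apply: fill Yy.
  have mEF s : s \in F -> mean_le0 act (fun x => \1_(exits A s) x - eta / 2).
    by move=> sF; apply: mE; rewrite in_fsetU sF orbT.
  have mU := uncovered_step F0 tau2 fillT mA mEF.
  apply: mean_le0_le mU => x; rewrite exprS.
  suff : (1 - tau) * ((1 - tau) ^+ n + eta / 2) + eta / 2 <=
    (1 - tau) * (1 - tau) ^+ n + eta by lra.
  by rewrite mulrDr; move: tau0; nra.
move=> g gL.
have gE : mean_le0 act (fun x => \1_(exits A g) x - eta / 2).
  by apply: mE; rewrite in_fsetU gL.
have hg : #|` (translate g F `\` F)%fset|%:R <= beta * #|` F|%:R.
  by apply: hF.2; rewrite in_fsetU gL orbT.
apply: mean_le0_le (exits_step tau2 mA' (ltW beta_gt0) hg gE) => x.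
have : beta <= eta / 4 by rewrite ge_min lexx orbT.
lra.
Qed.

End iteration.

End exhaustion.

(** * Almost finiteness in measure *)

Theorem theorem3p13 (R : realType) (G : groupType) (X : metricType R)
    (act : G -> X -> X)
    (hG : countable [set: G]) (hamen : amenable R G)
    (hcompact : compact [set: X]) (hzero : zero_dimensional X)
    (hact : group_action act) (hcont : forall g : G, continuous (act g))
    (hfree : free_action act) :
  almost_finite_in_measure act.
Proof.
move=> K delta epsilon K0 delta0 epsilon0.
have k1 : 0 < #|` K|%:R + 1 :> R by rewrite ltr_wpDl.
(* [8] in place of [4], to make the invariance of trimmed shapes strict *)
pose tau : R := Num.min 2^-1 (delta / (8 * (#|` K|%:R + 1))).
have tau_gt0 : 0 < tau by rewrite lt_min invr_gt0 divr_gt0 ?mulr_gt0 ?ltr0n.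
have tau2 : tau <= 2^-1 by rewrite ge_min lexx.
have tauK : 4 * tau * (#|` K|%:R + 1) < delta.
  have : tau <= delta / (8 * (#|` K|%:R + 1)) by rewrite ge_min lexx orbT.
  by rewrite ler_pdivlMr ?mulr_gt0 ?ltr0n //; lra.
have trim (F S : {fset G}) : folner K tau F -> (S `<=` F)%fset ->
    (1 - tau) * #|` F|%:R <= #|` S|%:R -> invariant_set K delta S.
  by move=> hF SF cS; apply: invariant_trimmed hF SF cS tau2 tauK.
have eps2 : 0 < epsilon / 2 by lra.
have [n powlt] : exists n, (1 - tau) ^+ n < epsilon / 2.
  have lt1 : `|1 - tau| < 1 by rewrite ltr_norml; lra.
  have /cvgr0Pnorm_lt/(_ _ eps2)[N _ /(_ N (leqnn N)) /=] := cvg_expr lt1.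
  by move=> /(le_lt_trans (ler_norm _)); exists N.
(* [n] rounds leave a part of density at most [(1 - tau) ^+ n + eta] *)
pose eta := (epsilon / 2 - (1 - tau) ^+ n) / 2.
have eta0 : 0 < eta by rewrite /eta; lra.
have [A [tA mA _]] := exhaustion hact hG hamen hcompact hzero hcont hfree delta0
  (ltW tau_gt0) tau2 tau_gt0 trim n fset0 eta0.
have [I [V [S [cVS clV PVS eA]]]] := tiled_castle tA.
exists I, V, S; split => //.
- by move=> i; case: (clV i).
- by move=> i s; apply: (PVS i).1.
- by move=> i; apply: (PVS i).2.
rewrite eA; apply: lower_density_ge hG hamen _ mA; rewrite /eta; lra.
Qed.
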